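(* Suppose $f:X\to Y$ is a map between uniform spaces that is approximated by uniform covering maps. Then $f$ has strong approximate uniqueness of chain lifts.
   Context: For a function $f:X\to Y$ and $E\subset X\times X$ put $f(E)=\{(f(x),f(y)):(x,y)\in E\}$. For uniform spaces $X,Y$, $f$ generates the uniform structure on $Y$ if $\{f(E): E \text{ an entourage of } X\}$ is a basis of that structure. For $E\subset X\times X$, an $E$-chain is a finite sequence $x_1,\ldots,x_n$ with $(x_i,x_{i+1})\in E$ for all $i<n$. Two chains $x_1,\ldots,x_n$ and $y_1,\ldots,y_n$ are $E$-close if $(x_i,y_i)\in E$ for all $i\le n$. Images of chains are taken termwise. - $f$ has chain lifting if for every entourage $E$ of $X$ there is an entourage $F$ of $X$ such that for every $x\in X$, any $f(F)$-chain in $Y$ starting at $f(x)$ lifts to an $E$-chain in $X$ starting at $x$. - $f$ has uniqueness of chain lifts if for every entourage $E$ of $X$ there is an entourage $F\subset E$ such that any two $F$-chains in $X$ starting at the same point with identical images under $f$ are equal. - $f$ is a uniform covering map if it generates the uniform structure on $Y$ and has chain lifting and uniqueness of chain lifts. - $f$ has strong approximate uniqueness of chain lifts if for every entourage $E$ of $X$ there is an entourage $F\subset E$ such that any two $F$-chains in $X$ starting at the same point with identical images under $f$ are $F$-close. - $f$ is approximated by uniform covering maps if for every entourage $E$ of $X$ there is an entourage $F\subset E$ such that $f$ factors as $X\xrightarrow{h_F}Z_F\xrightarrow{g_F}Y$, where $Z_F$ is a uniform space, $h_F$ is uniformly continuous with $F$-bounded fibers (i.e. $h_F^{-1}(z)\times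 h_F^{-1}(z)\subset F$ for all $z\in Z_F$), and $g_F$ is a uniform covering map. *)

(* Defs.v *)
From mathcomp Require Import all_boot all_order.
From mathcomp Require Import all_classical topology.

Set Implicit Arguments.
Unset Strict Implicit.
Unset Printing Implicit Defensive.

Local Open Scope classical_set_scope.

Definition image_rel {X Y : Type} (f : X -> Y) (E : set (X * X)) :
    set (Y * Y) :=
  [set (f p.1, f p.2) | p in E].

(* A library filter is the upward closure [filter_from] of each of its bases,
   so this equality says both that every [f(E)] is an entourage and that every
   entourage of [Y] contains some [f(E)]. *)
Definition generates_uniformity {X Y : uniformType} (f : X -> Y) : Prop :=
  @entourage Y = filter_from (@entourage X) (image_rel f).

(* As in [path], the chain [x_1, ..., x_n] (with [1 <= n]) is given by its
   starting point [x = x_1] and the remaining sequence [s = x_2, ..., x_n]. *)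
Definition is_chain {X : Type} (E : set (X * X)) (x : X) (s : seq X) : Prop :=
  path [rel a b | (a, b) \in E] x s.

(* [all2] also requires the two sequences to have the same length. *)
Definition close_chains {X : Type} (E : set (X * X)) (s t : seq X) : Prop :=
  all2 [rel a b | (a, b) \in E] s t.

Definition chain_lifting {X Y : uniformType} (f : X -> Y) : Prop :=
  forall E : set (X * X), entourage E ->
  exists2 F : set (X * X), entourage F &
    forall (x : X) (t : seq Y), is_chain (image_rel f F) (f x) t ->
    exists2 s : seq X, is_chain E x s & map f s = t.

Definition unique_chain_lifts {X Y : uniformType} (f : X -> Y) : Prop :=
  forall E : set (X * X), entourage E ->
  exists F : set (X * X), [/\ entourage F, F `<=` E &
    forall (x : X) (s t : seq X), is_chain F x s -> is_chain F x t ->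
    map f (x :: s) = map f (x :: t) -> x :: s = x :: t].

Definition uniform_covering_map {X Y : uniformType} (f : X -> Y) : Prop :=
  [/\ generates_uniformity f, chain_lifting f & unique_chain_lifts f].

Definition strong_approx_unique_chain_lifts {X Y : uniformType}
    (f : X -> Y) : Prop :=
  forall E : set (X * X), entourage E ->
  exists F : set (X * X), [/\ entourage F, F `<=` E &
    forall (x : X) (s t : seq X), is_chain F x s -> is_chain F x t ->
    map f (x :: s) = map f (x :: t) -> close_chains F (x :: s) (x :: t)].

Definition bounded_fibers {X Z : Type} (F : set (X * X)) (h : X -> Z) : Prop :=
  forall z : Z, (h @^-1` [set z]) `*` (h @^-1` [set z]) `<=` F.

Definition approximated_by_uniform_covering_maps {X Y : uniformType}
    (f : X -> Y) : Prop :=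
  forall E : set (X * X), entourage E ->
  exists F : set (X * X), [/\ entourage F, F `<=` E &
    exists (Z : uniformType) (h : X -> Z) (g : Z -> Y),
      [/\ f = g \o h, unif_continuous h, bounded_fibers F h &
          uniform_covering_map g]].

(* Main.v *)
Require Import Defs.
From mathcomp Require Import all_boot all_order.
From mathcomp Require Import all_classical topology.

(** Factor [f = g \o h] with [F]-bounded fibers of [h] and let [G] witness the
    uniqueness of chain lifts for [g].  The entourage [F] intersected with the
    preimage of [G] under [h] works: [h] sends two chains as in the definition
    to [G]-chains with the same lift data, hence to equal chains, and two points
    with the same image under [h] are [F]-close by boundedness of the fibers
    and have [G]-close images by reflexivity of [G]. *)

Set Implicit Arguments.
Unset Strict Implicit.
Unset Printing Implicit Defensive.

Local Open Scope classical_set_scope.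

Lemma is_chain_map {X Z : Type} (h : X -> Z) (E : set (X * X))
    (G : set (Z * Z)) (x : X) (s : seq X) :
  (forall a b, E (a, b) -> G (h a, h b)) ->
  is_chain E x s -> is_chain G (h x) (map h s).
Proof.
move=> EG; rewrite /is_chain path_map; apply: sub_path => a b /=.
by rewrite !inE; exact: EG.
Qed.

(** Equal images force equal lengths, and then each pair of corresponding terms lies in one fiber of
    [h]. *)
Lemma close_chains_fibers {X Z : Type} (h : X -> Z) (E : set (X * X))
    (s t : seq X) :
  (forall a b, h a = h b -> E (a, b)) ->
  map h s = map h t -> close_chains E s t.
Proof.
rewrite /close_chains => hE.
elim: s t => [|a s IHs] [|b t] //= [hab hst].
by rewrite IHs // andbT inE; exact: hE.
Qed.

Theorem proposition2p3 (X Y : uniformType) (f : X -> Y)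
  (hf : approximated_by_uniform_covering_maps f) :
  strong_approx_unique_chain_lifts f.
Proof.
move=> E entE.
have [F [entF FE [Z [h [g [fgh hcont hF [_ _ g_uniq]]]]]]] := hf E entE.
(* Containment in [E] will come from [F], so [G] may be of any size; hence [setT]. *)
have [G [entG _ Guniq]] := g_uniq setT entourageT.
exists (F `&` [set p | G (h p.1, h p.2)]); split.
- by apply: filterI => //; exact: hcont.
- by move=> p [/FE].
- move=> x s t chs cht fst.
  have HG a b : (F `&` [set p | G (h p.1, h p.2)]) (a, b) -> G (h a, h b).
    by case.
  apply: (close_chains_fibers (h := h)).
    move=> a b hab; split; first by apply: (hF (h b)).
    by rewrite /= hab; exact: entourage_refl.
  (* Both image chains start at [h x]; it remains to see that [g] identifies them, which is [fst]
     read through [f = g \o h]. *)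
  apply: Guniq (is_chain_map HG chs) (is_chain_map HG cht) _.
  by move: fst; rewrite fgh -!map_cons -!map_comp.
Qed.
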